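(* For $\pi\in S_{D+1}$, define $T(\pi)$ by $$A_{\pi^{-1}}^*\big(w_\mu(\xi)\big) = \sum_{\nu\in\mathcal{B}^-(\Delta_\lambda, r)} T(\pi)_{\mu\nu}\, w_\nu(\lambda), \qquad \mu\in\mathcal{B}^-(\Delta_\xi, r).$$ Then $T(\pi)$ is well defined, each row, indexed by $\mu = (f,e,\alpha)$, contains a single non-zero entry $\varepsilon(\pi(e))\in\{-1,+1\}$ or exactly two non-zero entries, $\varepsilon(\pi(e))$ and $-\varepsilon(\pi(e))$, and $T(\pi)^{-1} = T(\pi^{-1})$. The matrix depends on $r$ only through its index set $\mathcal{B}^-(\Delta_\xi, r)$.
   Context: $D \ge 1$ and $r \ge 1$ are integers and $\Delta = [v_0,\dots,v_D]\subset\mathbb{R}^D$ is a non-degenerate $D$-simplex with vertex labels $0,\dots,D$, naturally ordered. Its barycentric coordinates $\xi = (\xi_0,\dots,\xi_D)$ are the affine functions with $\xi_i(v_j) = \delta_{ij}$. A face is identified with its label set $f\subseteq\{0,\dots,D\}$; $\dim f = |f|-1$, $\min f$ is the smallest label. For $\alpha\in\mathbb{N}_0^{D+1}$, $|\alpha| = \sum_i\alpha_i$, $\operatorname{supp}(\alpha) = \{i:\alpha_i>0\}$, $b(\xi;\alpha) = \prod_i\xi_i^{\alpha_i}$. Whitney forms: $\varphi(\xi;i,j) = \xi_i\,\mathrm{d}\xi_j - \xi_j\,\mathrm{d}\xi_i$. For an ordered pair $e=(e_1,e_2)$ of distinct labels, $\varepsilon(e) = +1$ if $e_1<e_2$ and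 $-1$ otherwise, and $\pi(e) = (\pi(e_1),\pi(e_2))$. $\mathcal{B}^-(\Delta_\xi, r)$ is the set of triplets $\mu = (f,e,\alpha)$ with $\dim f\ge1$, $e = (e_1,e_2)$ a pair of labels of $f$ with $e_1 = \min f<e_2$, $|\alpha| = r-1$ and $\operatorname{supp}(\alpha)\cup\{e_1,e_2\} = f$; $w_\mu(\xi) = w(\xi;f,e,\alpha) = b(\xi;\alpha)\,\varphi(\xi;e_1,e_2)$. $S_{D+1}$ is the group of bijections of $\{0,\dots,D\}$. $\Delta_\xi$ and $\Delta_\lambda$ are two copies of $\Delta$ with barycentric coordinates denoted $\xi$ and $\lambda$; all definitions are also used on $\Delta_\lambda$ with $\lambda$ in place of $\xi$. As index sets, $\mathcal{B}^-(\Delta_\xi, r)$ and $\mathcal{B}^-(\Delta_\lambda, r)$ are the same set of triplets, so $T(\pi)$ is a square matrix indexed by this set. $A_\pi:\Delta_\xi\to\Delta_\lambda$ is the affine map with $A_\pi(v_i) = v_{\pi(i)}$; the pullback $A_{\pi^{-1}}^*$ takes forms on $\Delta_\xi$ to forms on $\Delta_\lambda$ and is the substitution $\xi_i\mapsto\lambda_{\pi(i)}$, $\mathrm{d}\xi_i\mapsto\mathrm{d}\lambda_{\pi(i)}$. ''Depends on $r$ only through its index set'' means that the rule giving the entry $T(\pi)_{\mu\nu}$ from the triplets $\mu,\nu$ and $\pi$ is the same for all $r$. *)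

(* Defs.v *)
From HB Require Import structures.
From mathcomp Require Import all_boot all_order all_algebra all_fingroup.
From mathcomp Require Import all_classical all_reals all_analysis.
Import Order.TTheory GRing.Theory Num.Theory.
Import numFieldNormedType.Exports.

Set Implicit Arguments.
Unset Strict Implicit.
Unset Printing Implicit Defensive.

Local Open Scope ring_scope.

Definition affine_map (R : realType) (V W : lmodType R) (f : V -> W) : Prop :=
  exists (L : {linear V -> W}) (c : W), forall x, f x = L x + c.

Definition nondegenerate_simplex (R : realType) (D : nat)
    (v : 'I_D.+1 -> 'rV[R]_D) : Prop :=
  row_free (\matrix_(i < D) (v (lift ord0 i) - v ord0)).

Definition simplex (R : realType) (D : nat) (v : 'I_D.+1 -> 'rV[R]_D) :
    set 'rV[R]_D :=
  [set x | exists t : 'I_D.+1 -> R,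
     [/\ forall i, 0 <= t i, \sum_i t i = 1 & x = \sum_i t i *: v i]]%classic.

Definition barycentric (R : realType) (D : nat) (v : 'I_D.+1 -> 'rV[R]_D)
    (xi : 'I_D.+1 -> 'rV[R]_D -> R) : Prop :=
  forall i, affine_map (xi i : 'rV[R]_D -> R^o) /\
    forall j, xi i (v j) = (i == j)%:R.

(* A differential 1-form [w] on R^D is given by its values [w x h] at the point
   [x] on the tangent vector [h]. *)
Definition form1 (R : realType) (D : nat) : Type :=
  'rV[R]_D -> 'rV[R]_D -> R.

Definition dform (R : realType) (D : nat) (f : 'rV[R]_D -> R) : form1 R D :=
  fun x h => 'd f x h.

Definition pullback (R : realType) (D : nat) (F : 'rV[R]_D -> 'rV[R]_D)
    (w : form1 R D) : form1 R D :=
  fun x h => w (F x) ('d F x h).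

Definition bmonomial (R : realType) (D : nat) (xi : 'I_D.+1 -> 'rV[R]_D -> R)
    (alpha : {ffun 'I_D.+1 -> nat}) : 'rV[R]_D -> R :=
  fun x => \prod_i xi i x ^+ alpha i.

Definition whitney (R : realType) (D : nat) (xi : 'I_D.+1 -> 'rV[R]_D -> R)
    (i j : 'I_D.+1) : form1 R D :=
  fun x h => xi i x * dform (xi j) x h - xi j x * dform (xi i) x h.

Definition triplet (D : nat) : Type :=
  ({set 'I_D.+1} * ('I_D.+1 * 'I_D.+1) * {ffun 'I_D.+1 -> nat})%type.

Definition face (D : nat) (mu : triplet D) : {set 'I_D.+1} := mu.1.1.
Definition edge (D : nat) (mu : triplet D) : 'I_D.+1 * 'I_D.+1 := mu.1.2.
Definition expo (D : nat) (mu : triplet D) : {ffun 'I_D.+1 -> nat} := mu.2.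

Definition dimf (D : nat) (f : {set 'I_D.+1}) : nat := #|f|.-1.

Definition is_min (D : nat) (f : {set 'I_D.+1}) (i : 'I_D.+1) : bool :=
  (i \in f) && [forall j in f, (i <= j)%N].

Definition supp (D : nat) (alpha : {ffun 'I_D.+1 -> nat}) : {set 'I_D.+1} :=
  [set i | (0 < alpha i)%N]%SET.

Definition in_Bminus (D r : nat) (mu : triplet D) : bool :=
  let f := face mu in let e := edge mu in let alpha := expo mu in
  [&& (1 <= dimf f)%N,
      (e.1 \in f) && (e.2 \in f),
      is_min f e.1 && (e.1 < e.2)%N,
      (\sum_i alpha i == r.-1)%N
    & supp alpha :|: [set e.1; e.2]%SET == f].

Record Bminus (D r : nat) : Type := MkBminus {
  Bminus_triplet :> triplet D;
  BminusP : in_Bminus r Bminus_triplet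
}.

HB.instance Definition _ (D r : nat) := [isSub for @Bminus_triplet D r].
HB.instance Definition _ (D r : nat) := [Countable of Bminus D r by <:].

Section BminusFinite.
Variables D r : nat.

(* Exponents of total degree [r.-1] take their values in ['I_r.-1.+1]. *)
Let bounded : finType :=
  ({set 'I_D.+1} * ('I_D.+1 * 'I_D.+1) * {ffun 'I_D.+1 -> 'I_r.-1.+1})%type.

Let code (mu : Bminus D r) : bounded :=
  (face mu, edge mu, [ffun i => inord (expo mu i)]).

Let decode (x : bounded) : option (Bminus D r) :=
  insub (x.1, [ffun i => nat_of_ord (x.2 i)] : {ffun 'I_D.+1 -> nat}).

Fact Bminus_codeK : pcancel code decode.
Proof.
move=> mu; rewrite /decode /code /=.
set m := (X in insub X); suff -> : m = val mu by rewrite valK.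
case: mu @m => -[[f e] alpha] /= /and5P[_ _ _ /eqP deg _].
congr (_, _); apply/ffunP => i; rewrite !ffunE inordK // ltnS -deg.
by rewrite [X in (_ <= X)%N](bigD1 i) //= leq_addr.
Qed.

HB.instance Definition _ : fintype.isFinite (Bminus D r) :=
  PCanIsFinite Bminus_codeK.

End BminusFinite.

Definition wform (R : realType) (D : nat) (xi : 'I_D.+1 -> 'rV[R]_D -> R)
    (mu : triplet D) : form1 R D :=
  fun x h => bmonomial xi (expo mu) x * whitney xi (edge mu).1 (edge mu).2 x h.

Definition edge_sign (R : realType) (D : nat) (e : 'I_D.+1 * 'I_D.+1) : R :=
  if (e.1 < e.2)%N then 1 else -1.

Definition perm_edge (D : nat) (pi : 'S_D.+1) (e : 'I_D.+1 * 'I_D.+1) :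
    'I_D.+1 * 'I_D.+1 :=
  (pi e.1, pi e.2).

(* Matrices indexed by [Bminus D r] are square matrices of size its cardinal,
   through the canonical enumeration of this finite type. *)
Definition entry (R : realType) (D r : nat) (M : 'M[R]_#|{: Bminus D r}|)
    (mu nu : Bminus D r) : R :=
  M (enum_rank mu) (enum_rank nu).

(* Equality of forms on the simplex, i.e. at its points and on all tangent
   vectors. *)
Definition is_transition (R : realType) (D : nat) (v : 'I_D.+1 -> 'rV[R]_D)
    (xi lam : 'I_D.+1 -> 'rV[R]_D -> R) (A : 'S_D.+1 -> 'rV[R]_D -> 'rV[R]_D)
    (r : nat) (pi : 'S_D.+1) (M : 'M[R]_#|{: Bminus D r}|) : Prop :=
  forall (mu : Bminus D r) (x : 'rV[R]_D), simplex v x ->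
  forall h : 'rV[R]_D,
    pullback (A (pi^-1)%g) (wform xi mu) x h =
    \sum_(nu : Bminus D r) entry M mu nu * wform lam nu x h.

Definition row_single (R : realType) (D r : nat) (M : 'M[R]_#|{: Bminus D r}|)
    (mu : Bminus D r) (c : R) : Prop :=
  exists nu, entry M mu nu = c /\
    forall nu', nu' != nu -> entry M mu nu' = 0.

Definition row_double (R : realType) (D r : nat) (M : 'M[R]_#|{: Bminus D r}|)
    (mu : Bminus D r) (c : R) : Prop :=
  exists nu1 nu2, [/\ nu1 != nu2, entry M mu nu1 = c, entry M mu nu2 = - c &
    forall nu', nu' != nu1 -> nu' != nu2 -> entry M mu nu' = 0].

Definition perm_expo (D : nat) (pi : 'S_D.+1)
    (gamma : {ffun 'I_D.+1 -> nat}) : {ffun 'I_D.+1 -> nat} :=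
  [ffun i => gamma ((pi^-1)%g i)].

Definition shift_triplet (D : nat) (gamma : {ffun 'I_D.+1 -> nat}) (mu : triplet D) :
    triplet D :=
  (face mu, edge mu, [ffun i => (expo mu i + gamma i)%N]).

(* A function of the triplets alone could still recover [r], as
   [r.-1 = \sum_i expo mu i]. That the same rule is used for all [r] is
   expressed by comparing its values in different degrees: they do not change
   when the bmonomial of [mu] is multiplied by another one, and that of [nu] by
   the pullback of the latter. *)
Definition degree_independent (R : realType) (D : nat)
    (rule : 'S_D.+1 -> triplet D -> triplet D -> R) : Prop :=
  forall pi gamma mu nu,
    rule pi (shift_triplet gamma mu) (shift_triplet (perm_expo pi gamma) nu) = rule pi mu nu.

(* Main.v *)
(* In barycentric coordinates t of the point and s of the tangent vector, w_mu
   becomes t^alpha (t_e1 s_e2 - t_e2 s_e1), and the pullback permutes the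
   coordinates. The term t^(alpha + delta_e1) s_e2 determines mu, because
   e1 = min f, and it occurs in no other w_nu; this gives linear independence.
   Permuting the labels of w_mu gives t^gamma (t_p s_q - t_q s_p) with
   gamma = alpha o pi^-1, p = pi(e1), q = pi(e2), which is a signed basis form
   when the smallest label m of pi(f) is p or q, and otherwise a difference of
   two basis forms by
   t_m phi(p, q) = t_p phi(m, q) - t_q phi(m, p). Reading off the coefficient of
   w_nu as the coefficient of its determining term gives a formula for
   T(pi)_{mu nu} in which the degree does not occur. *)
Require Import Defs.
From HB Require Import structures.
From mathcomp Require Import all_boot all_order all_algebra all_fingroup.
From mathcomp Require Import all_classical all_reals all_analysis.
From mathcomp Require Import ring zify.
Import Order.TTheory GRing.Theory Num.Theory.
Import numFieldNormedType.Exports.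

Set Implicit Arguments.
Unset Strict Implicit.
Unset Printing Implicit Defensive.

Local Open Scope ring_scope.

(** * Affine maps and forms in barycentric coordinates *)

Lemma rV_linear_continuous (R : realType) (D : nat) (W : normedModType R)
  (f : {linear 'rV[R]_D -> W}) : continuous f.
Proof.
have -> : (f : 'rV[R]_D -> W) =
    (fun x => \sum_(k < D) x ord0 k *: f (delta_mx ord0 k)).
  apply/funext => x; rewrite {1}(row_sum_delta x) linear_sum.
  by apply: eq_bigr => k _; rewrite linearZ.
apply: continuous_big => [|k _]; first exact: add_continuous.
by move=> x; apply: cvgZr_tmp; [exact: nbhs_filter|exact: coord_continuous].
Qed.

Section AffineMaps.
Variables (R : realType) (D : nat) (v : 'I_D.+1 -> 'rV[R]_D).

Definition comb (V : lmodType R) (u : 'I_D.+1 -> V) (t : 'I_D.+1 -> R) : V :=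
  \sum_i t i *: u i.

Lemma affine_comb (V W : lmodType R) (f : V -> W) (u : 'I_D.+1 -> V) t :
  affine_map f -> \sum_i t i = 1 -> f (comb u t) = comb (f \o u) t.
Proof.
move=> [L [c fE]] t1; rewrite fE linear_sum -[X in _ + X]scale1r -t1.
rewrite scaler_suml -big_split; apply: eq_bigr => i _ /=.
by rewrite linearZ -scalerDr -fE.
Qed.

(** Since the weights [s] sum to 0, adding [(\sum_i s i) *: c] changes nothing and turns each
    [L (v i)] into [f (v i)]. *)
Lemma diff_affine_comb (W : normedModType R) (f : 'rV[R]_D -> W) x s :
  affine_map f -> \sum_i s i = 0 -> 'd f x (comb v s) = comb (f \o v) s.
Proof.
move=> [L [c fE]] s0.
have -> : f = (L : _ -> _) + cst c by apply/funext => y; rewrite fE.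
have cL := @rV_linear_continuous R D W L.
rewrite diffD; [|exact: linear_differentiable|exact: differentiable_cst].
rewrite /= diff_lin// diff_cst /= addr0 linear_sum.
rewrite -[LHS]addr0 -[X in _ + X](scale0r c) -s0 scaler_suml -big_split.
by apply: eq_bigr => i _ /=; rewrite linearZ -scalerDr.
Qed.

Hypothesis hv : nondegenerate_simplex v.

(** The edge vectors at [v ord0] form a basis; the coordinates of [h] in it serve as weights, and
    [v ord0] receives minus their sum. *)
Lemma direction_comb h : exists2 s, \sum_i s i = 0 & h = comb v s.
Proof.
set M := \matrix_(i < D) (v (lift ord0 i) - v ord0).
have Mu : M \in unitmx by rewrite -row_free_unit.
pose u := h *m invmx M.
exists (fun i => if unlift ord0 i is Some j then u ord0 j
                 else - \sum_j u ord0 j).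
  rewrite big_ord_recl unlift_none addrC -[RHS](subrr (\sum_j u ord0 j)).
  by congr (_ + _); apply: eq_bigr => i _; rewrite liftK.
rewrite /comb big_ord_recl unlift_none -[LHS](mulmxKV Mu) -/u mulmx_sum_row.
rewrite scaleNr scaler_suml addrC -sumrB; apply: eq_bigr => i _.
by rewrite liftK rowK scalerBr.
Qed.

Lemma point_comb x : exists2 t, \sum_i t i = 1 & x = comb v t.
Proof.
have [s s0 xE] := direction_comb (x - v ord0).
exists (fun i => s i + (i == ord0)%:R).
  rewrite big_split /= s0 add0r (bigD1 ord0)//= big1 ?addr0// => i /negPf->//.
rewrite /comb; under eq_bigr do rewrite scalerDl.
rewrite big_split /= -/(comb v s) -xE (bigD1 ord0)//= scale1r.
rewrite big1 ?addr0 ?subrK//.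
by move=> i /negPf->; rewrite scale0r.
Qed.

Lemma barycentric_comb (lam : 'I_D.+1 -> 'rV[R]_D -> R) t i :
  barycentric v lam -> \sum_i t i = 1 -> lam i (comb v t) = t i.
Proof.
move=> hlam t1; have [aff lamv] := hlam i.
rewrite (affine_comb _ aff)// /comb (bigD1 i)//= lamv eqxx [_ *: _]mulr1.
rewrite big1 ?addr0// => j ji; rewrite lamv eq_sym (negPf ji).
exact: mulr0.
Qed.

Lemma dform_comb (lam : 'I_D.+1 -> 'rV[R]_D -> R) x s i :
  barycentric v lam -> \sum_i s i = 0 -> dform (lam i) x (comb v s) = s i.
Proof.
move=> hlam s0; have [aff lamv] := hlam i.
rewrite /dform (diff_affine_comb _ aff)// /comb (bigD1 i)//= lamv eqxx.
rewrite [_ *: _]mulr1 big1 ?addr0// => j ji; rewrite lamv eq_sym (negPf ji).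
exact: mulr0.
Qed.

End AffineMaps.

(* [t] are the barycentric coordinates of the point, with sum 1, and [s] those of
   the tangent vector, with sum 0. *)
Definition wpoly (R : realType) (D : nat) (mu : triplet D)
    (t s : 'I_D.+1 -> R) : R :=
  (\prod_i t i ^+ expo mu i) *
  (t (edge mu).1 * s (edge mu).2 - t (edge mu).2 * s (edge mu).1).

Lemma wform_comb (R : realType) (D : nat) (v : 'I_D.+1 -> 'rV[R]_D) lam mu t s :
  barycentric v lam -> \sum_i t i = 1 -> \sum_i s i = 0 ->
  wform lam mu (comb v t) (comb v s) = wpoly mu t s.
Proof.
move=> hlam t1 s0; rewrite /wform /bmonomial /whitney /wpoly.
rewrite !(dform_comb _ _ hlam)// !(barycentric_comb _ hlam)//.
by under eq_bigr do rewrite (barycentric_comb _ hlam)//.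
Qed.

Lemma comb_perm (R : realType) (D : nat) (V : lmodType R) (u : 'I_D.+1 -> V)
    (pi : 'S_D.+1) t :
  comb (u \o (pi^-1)%g) t = comb u (t \o pi).
Proof.
rewrite /comb (reindex_inj (@perm_inj _ pi)); apply: eq_bigr => i _ /=.
by rewrite permK.
Qed.

(** [F] permutes the vertices by [pi^-1], so the images of the point and of the tangent vector have
    coordinates [t \o pi] and [s \o pi]. *)
Lemma pullback_wform_comb (R : realType) (D : nat) (v : 'I_D.+1 -> 'rV[R]_D) xi
    (F : 'rV[R]_D -> 'rV[R]_D) (pi : 'S_D.+1) mu t s :
  barycentric v xi -> affine_map F -> (forall i, F (v i) = v ((pi^-1)%g i)) ->
  \sum_i t i = 1 -> \sum_i s i = 0 ->
  pullback F (wform xi mu) (comb v t) (comb v s) = wpoly mu (t \o pi) (s \o pi).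
Proof.
move=> hxi aF Fv t1 s0; rewrite /pullback affine_comb// diff_affine_comb//.
have -> : F \o v = v \o (pi^-1)%g by apply/funext => i; exact: Fv.
rewrite !comb_perm wform_comb//.
  by rewrite -[RHS]t1 [RHS](reindex_inj (@perm_inj _ pi)).
by rewrite -[RHS]s0 [RHS](reindex_inj (@perm_inj _ pi)).
Qed.

(** * Encoding the elementary terms of the basis forms *)

Section Keys.
Variable D : nat.
Implicit Types (alpha beta gamma : {ffun 'I_D.+1 -> nat}) (mu : triplet D).

Definition raise alpha (i : 'I_D.+1) : {ffun 'I_D.+1 -> nat} :=
  [ffun j => (alpha j + (j == i))%N].

(* The form [w_mu] is the difference of the elementary terms
   [xi^(alpha + delta_e1) d xi_e2] and [xi^(alpha + delta_e2) d xi_e1], encoded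
   by [key mu] and [cokey mu]. *)
Definition key mu := (raise (expo mu) (edge mu).1, (edge mu).2).
Definition cokey mu := (raise (expo mu) (edge mu).2, (edge mu).1).

(** For a triplet in [Bminus], both [key] and [cokey] give back the face, and with it the first edge
    label. *)
Definition key_face (k : {ffun 'I_D.+1 -> nat} * 'I_D.+1) : {set 'I_D.+1} :=
  supp k.1 :|: [set k.2].

Lemma raise_inj i : injective (raise^~ i).
Proof.
move=> a b /ffunP ab; apply/ffunP => j.
by move: (ab j); rewrite !ffunE => /addIn.
Qed.

Lemma raiseC alpha i j : raise (raise alpha i) j = raise (raise alpha j) i.
Proof. by apply/ffunP => k; rewrite !ffunE addnAC. Qed.

Lemma sum_raise alpha i : (\sum_j raise alpha i j = (\sum_j alpha j).+1)%N.
Proof.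
under eq_bigr do rewrite ffunE.
rewrite big_split /= -[RHS]addn1; congr addn.
by rewrite (bigD1 i)//= eqxx big1// => j /negPf->.
Qed.

Lemma key_face_raise alpha i j :
  key_face (raise alpha i, j) = supp alpha :|: [set i; j].
Proof.
apply/setP => k; rewrite !inE ffunE addn_gt0 -orbA.
by case: (k == i); rewrite ?orbT.
Qed.

Lemma is_min_uniq (f : {set 'I_D.+1}) i j : is_min f i -> is_min f j -> i = j.
Proof.
move=> /andP[fi /forall_inP mi] /andP[fj /forall_inP mj].
by apply/val_inj/anti_leq/andP; split; [exact: mi|exact: mj].
Qed.

Lemma ex_is_min (f : {set 'I_D.+1}) i : i \in f -> exists m, is_min f m.
Proof.
move=> fi; case: (arg_minnP (fun j : 'I_D.+1 => val j) fi) => m fm mle.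
by exists m; apply/andP; split => //; apply/forall_inP => j; exact: mle.
Qed.

Section Bminus.
Variable r : nat.
Implicit Types nu rho : Bminus D r.

Lemma Bminus_lt nu : ((edge nu).1 < (edge nu).2)%N.
Proof. by have /and5P[_ _ /andP[_ ->]] := BminusP nu. Qed.

Lemma Bminus_min nu : is_min (face nu) (edge nu).1.
Proof. by have /and5P[_ _ /andP[->]] := BminusP nu. Qed.

Lemma Bminus_sum nu : (\sum_i expo nu i = r.-1)%N.
Proof. by have /and5P[_ _ _ /eqP] := BminusP nu. Qed.

Lemma Bminus_face nu : face nu = supp (expo nu) :|: [set (edge nu).1; (edge nu).2].
Proof. by have /and5P[_ _ _ _ /eqP] := BminusP nu. Qed.

Lemma key_faceE nu : key_face (key nu) = face nu.
Proof. by rewrite key_face_raise Bminus_face. Qed.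

Lemma cokey_faceE nu : key_face (cokey nu) = face nu.
Proof. by rewrite key_face_raise Bminus_face [[set _; _]]finset.setUC. Qed.

(** Equal keys give equal faces; the first edge label is the minimum of the face, so it agrees and
    the raising can be undone. *)
Lemma key_inj nu rho : key nu = key rho -> nu = rho.
Proof.
move=> kE; have fE : face nu = face rho by rewrite -!key_faceE kE.
have e1 : (edge nu).1 = (edge rho).1.
  by apply: (@is_min_uniq (face nu)); rewrite ?Bminus_min// fE Bminus_min.
case: kE; rewrite e1 => /raise_inj aE e2; apply: val_inj => /=.
move: fE e1 e2 aE; rewrite /face /edge /expo.
case: (nu : triplet D) => -[f [? ?]] a.
by case: (rho : triplet D) => -[f' [? ?]] a' /= -> -> -> ->.
Qed.

(** The faces would agree, hence also their minima; but the differential label of a key is never the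
    minimum, while that of a cokey always is. *)
Lemma key_neq_cokey nu rho : key nu != cokey rho.
Proof.
apply/eqP => kE; have fE : face nu = face rho.
  by rewrite -key_faceE kE cokey_faceE.
have e1 : (edge nu).1 = (edge rho).1.
  by apply: (@is_min_uniq (face nu)); rewrite ?Bminus_min// fE Bminus_min.
by case: kE => _; rewrite -e1 => e2; have := Bminus_lt nu; rewrite e2 ltnn.
Qed.

(** As [m] lies in the face and differs from [q], it is in the support of [beta], so one factor of
    index [m] can be split off. *)
Lemma Bminus_of_key beta m q : (1 <= r)%N -> (\sum_i beta i = r)%N ->
  is_min (key_face (beta, q)) m -> m != q ->
  exists nu, edge nu = (m, q) /\ key nu = (beta, q).
Proof.
move=> r1 bsum mmin mq; have /andP[fm /forall_inP mle] := mmin.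
have bm : (0 < beta m)%N by move: fm; rewrite !inE (negPf mq) orbF.
pose alpha := [ffun j => (beta j - (j == m))%N] : {ffun 'I_D.+1 -> nat}.
have aE : raise alpha m = beta.
  by apply/ffunP => j; rewrite !ffunE subnK//; case: eqP => // ->.
pose mu : triplet D := (key_face (beta, q), (m, q), alpha).
suff muP : in_Bminus r mu.
  by exists (MkBminus muP); split=> //; rewrite /key /= aE.
have fq : q \in key_face (beta, q) by rewrite !inE eqxx orbT.
have ltmq : (m < q)%N by rewrite ltn_neqAle mle// andbT.
rewrite /in_Bminus /face /edge /expo /= fm fq mmin ltmq /=; apply/and3P; split.
- rewrite /dimf -ltnS prednK; last by apply/card_gt0P; exists m.
  apply: (@leq_trans #|[set m; q]|); first by rewrite cards2 mq.
  apply: subset_leq_card; apply/fintype.subsetP => i.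
  by rewrite !inE => /orP[]/eqP->//; rewrite ?eqxx ?orbT// bm.
- by rewrite -eqSS prednK// -bsum -aE sum_raise.
- by rewrite -key_face_raise aE.
Qed.

End Bminus.
End Keys.

(** * Straightening the permuted forms, and the rule for the entries *)

Section Terms.
Variables (R : realType) (D : nat).
Implicit Types (t s : 'I_D.+1 -> R) (alpha beta gamma : {ffun 'I_D.+1 -> nat}).

Definition term (k : {ffun 'I_D.+1 -> nat} * 'I_D.+1) t s : R :=
  (\prod_i t i ^+ k.1 i) * s k.2.

Lemma prod_raise alpha i t :
  \prod_j t j ^+ raise alpha i j = (\prod_j t j ^+ alpha j) * t i.
Proof.
under eq_bigr do rewrite ffunE exprD.
rewrite big_split /=; congr (_ * _).
by rewrite (bigD1 i)//= eqxx big1 ?mulr1// => j /negPf->.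
Qed.

Lemma wpolyE (mu : triplet D) t s :
  wpoly mu t s = term (key mu) t s - term (cokey mu) t s.
Proof. by rewrite /wpoly /term /= !prod_raise mulrBr !mulrA. Qed.

Definition perm_key (pi : 'S_D.+1) (k : {ffun 'I_D.+1 -> nat} * 'I_D.+1) :=
  (perm_expo pi k.1, pi k.2).

Lemma term_perm pi k t s : term (perm_key pi k) t s = term k (t \o pi) (s \o pi).
Proof.
rewrite /term /=; congr (_ * _).
rewrite (reindex_inj (@perm_inj _ pi)); apply: eq_bigr => i _.
by rewrite ffunE permK.
Qed.

Lemma perm_expo_raise pi alpha i :
  perm_expo pi (raise alpha i) = raise (perm_expo pi alpha) (pi i).
Proof.
by apply/ffunP => j; rewrite !ffunE -(inj_eq (@perm_inj _ pi)) permKV.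
Qed.

Lemma sum_perm_expo pi alpha : (\sum_i perm_expo pi alpha i = \sum_i alpha i)%N.
Proof.
rewrite (reindex_inj (@perm_inj _ pi)); apply: eq_bigr => i _.
by rewrite ffunE permK.
Qed.

(* [lam_m phi(p, q) = lam_p phi(m, q) - lam_q phi(m, p)], applied to the
   smallest label [m] of the face, gives the second alternative. *)
Lemma term_straighten r gamma (p q : 'I_D.+1) : (1 <= r)%N ->
  (\sum_i gamma i = r.-1)%N -> (p < q)%N ->
  exists2 nu1 : Bminus D r, key nu1 = (raise gamma p, q) &
    ((forall nu : Bminus D r, key nu != (raise gamma q, p)) /\
     (forall t s, term (raise gamma p, q) t s - term (raise gamma q, p) t s =
        wpoly nu1 t s)) \/
    (exists2 nu2 : Bminus D r, key nu2 = (raise gamma q, p) &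
     (forall t s, term (raise gamma p, q) t s - term (raise gamma q, p) t s =
        wpoly nu1 t s - wpoly nu2 t s)).
Proof.
move=> r1 gsum ltpq.
have sumr i : (\sum_j raise gamma i j = r)%N by rewrite sum_raise gsum prednK.
have FE : key_face (raise gamma q, p) = key_face (raise gamma p, q).
  by rewrite !key_face_raise [[set q; p]]finset.setUC.
have [|m mmin] := @ex_is_min D (key_face (raise gamma p, q)) q.
  by rewrite !inE eqxx orbT.
(* Both terms have the same face, so [m <= p < q]: the first term is a key in either case. *)
have mp : (m <= p)%N.
  by have /andP[_ /forall_inP->//] := mmin; rewrite -FE !inE eqxx orbT.
have mq : m != q by rewrite neq_ltn (leq_ltn_trans mp ltpq).
have [nu1 [e1 k1]] := Bminus_of_key r1 (sumr p) mmin mq.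
exists nu1 => //.
have x1 : raise (expo nu1) m = raise gamma p by case: k1; rewrite e1.
(* If [m = p], the second term is [cokey nu1], and it is no key because its label is the minimum of
   its face. *)
have [mpE|mp'] := eqVneq m p.
  left; split=> [nu|t s].
    apply/eqP => kE; have : (edge nu).1 = m.
      apply: (@is_min_uniq D (face nu)); first exact: Bminus_min.
      by rewrite -key_faceE kE FE.
    have := Bminus_lt nu; case: kE => _ ->; rewrite -mpE => + E.
    by rewrite E ltnn.
  rewrite wpolyE k1 /cokey e1 /=; move: x1; rewrite mpE => /raise_inj ->.
  by [].
right; rewrite -FE in mmin.
have [nu2 [e2 k2]] := Bminus_of_key r1 (sumr q) mmin mp'.
have x2 : raise (expo nu2) m = raise gamma q by case: k2; rewrite e2.
exists nu2 => // t s; rewrite !wpolyE k1 k2 /cokey e1 e2 /=.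
(* The two cokeys coincide, both with differential label [m], and cancel in the difference. *)
have -> : raise (expo nu1) q = raise (expo nu2) p.
  by apply: (@raise_inj _ m); rewrite raiseC x1 [RHS]raiseC x2 raiseC.
by ring.
Qed.

Definition rule (pi : 'S_D.+1) (mu nu : triplet D) : R :=
  (key nu == perm_key pi (key mu))%:R - (key nu == perm_key pi (cokey mu))%:R.

(** The shift adds the same exponent to both sides of each key comparison, where it cancels. *)
Lemma rule_degree_independent : degree_independent rule.
Proof.
move=> pi gamma mu nu; rewrite /rule /key /cokey /perm_key /shift_triplet /=.
rewrite /edge /expo /= !perm_expo_raise !xpair_eqE.
suff shiftE (a b : {ffun 'I_D.+1 -> nat}) i j :
    (raise [ffun k => a k + perm_expo pi gamma k]%N i ==
    raise (perm_expo pi [ffun k => b k + gamma k]%N) j) =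
    (raise a i == raise (perm_expo pi b) j) by rewrite !shiftE.
apply/eqP/eqP => /ffunP E; apply/ffunP => k; have := E k; rewrite !ffunE; lia.
Qed.

(** Straightening applies to [(p, q)] or, at the cost of the sign [c], to [(q, p)]. The same [nu1]
    and [nu2] describe the row of [rule] and the expansion of the permuted form, which links the
    two. *)
Lemma rule_row r pi (mu : Bminus D r) : (1 <= r)%N ->
  let c := edge_sign R (perm_edge pi (edge mu)) in
  (exists nu1 : Bminus D r,
    (forall nu : Bminus D r, rule pi mu nu = c * (nu == nu1)%:R) /\
    (forall t s, wpoly mu (t \o pi) (s \o pi) = c * wpoly nu1 t s)) \/
  (exists nu1 nu2 : Bminus D r,
    [/\ nu1 != nu2,
     forall nu : Bminus D r,
       rule pi mu nu = c * (nu == nu1)%:R - c * (nu == nu2)%:R &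
     forall t s, wpoly mu (t \o pi) (s \o pi) =
       c * wpoly nu1 t s - c * wpoly nu2 t s]).
Proof.
move=> r1 c; set p := pi (edge mu).1; set q := pi (edge mu).2.
set gamma := perm_expo pi (expo mu).
have kE : perm_key pi (key mu) = (raise gamma p, q).
  by rewrite /perm_key /= perm_expo_raise.
have k'E : perm_key pi (cokey mu) = (raise gamma q, p).
  by rewrite /perm_key /= perm_expo_raise.
have gsum : (\sum_i gamma i = r.-1)%N by rewrite sum_perm_expo Bminus_sum.
have key_eq (nu1 nu : Bminus D r) k :
    key nu1 = k -> (key nu == k) = (nu == nu1).
  by move=> <-; apply/eqP/eqP => [/key_inj|->].
have wE t s : wpoly mu (t \o pi) (s \o pi) =
    term (raise gamma p, q) t s - term (raise gamma q, p) t s.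
  by rewrite wpolyE -!term_perm kE k'E.
rewrite /rule kE k'E /c /edge_sign /= -/p -/q.
have [ltpq|leqp] := ltnP p q.
  have [nu1 k1 [[no2 w1]|[nu2 k2 w12]]] := term_straighten r1 gsum ltpq.
    left; exists nu1; split=> [nu|t s]; last by rewrite wE w1 mul1r.
    by rewrite (key_eq _ _ _ k1) (negPf (no2 nu)) subr0 mul1r.
  right; exists nu1, nu2; split=> [|nu|t s]; last by rewrite wE w12 !mul1r.
    by apply/eqP => nuE; move: (congr1 snd k1); rewrite nuE k2 /= => pqE;
      move: ltpq; rewrite pqE ltnn.
  rewrite (key_eq _ _ _ k1) (key_eq _ _ _ k2).
  by congr (_ - _); rewrite mul1r.
have ltqp : (q < p)%N.
  rewrite ltn_neqAle leqp andbT (inj_eq val_inj) (inj_eq (@perm_inj _ pi)).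
  by rewrite neq_ltn (Bminus_lt mu) orbT.
have [nu1 k1 [[no2 w1]|[nu2 k2 w12]]] := term_straighten r1 gsum ltqp.
  left; exists nu1; split=> [nu|t s]; last by rewrite wE mulN1r -w1 opprB.
  by rewrite (key_eq _ _ _ k1) (negPf (no2 nu)) sub0r mulN1r.
right; exists nu1, nu2; split=> [|nu|t s].
- by apply/eqP => nuE; move: (congr1 snd k1); rewrite nuE k2 /= => pqE;
    move: ltqp; rewrite pqE ltnn.
- rewrite (key_eq _ _ _ k1) (key_eq _ _ _ k2) addrC.
  by congr (_ + _); rewrite mulN1r ?opprK.
- by rewrite wE !mulN1r -opprD -w12 opprB.
Qed.

End Terms.

(** * Linear independence of the basis forms *)

Section Independence.
Variables (R : realType) (D r : nat).

Definition base_code (n N : nat) (alpha : 'I_n -> nat) : nat :=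
  (\sum_i alpha i * N ^ i)%N.

(** Reduction modulo [N] recovers the lowest digit; the remaining digits follow by induction. *)
Lemma base_code_inj (n N : nat) (alpha beta : 'I_n -> nat) :
  (forall i, alpha i < N)%N -> (forall i, beta i < N)%N ->
  base_code N alpha = base_code N beta -> alpha =1 beta.
Proof.
elim: n alpha beta => [|n IHn] alpha beta ltaN ltbN; first by move=> _ [].
have N0 : (0 < N)%N by apply: leq_ltn_trans (ltaN ord0).
have codeS a : base_code N a =
    (base_code N (a \o lift ord0) * N + a ord0)%N.
  rewrite /base_code big_ord_recl expn0 muln1 addnC big_distrl; congr addn.
  by apply: eq_bigr => i _; rewrite /= expnSr mulnA.
rewrite !codeS => E.
have E0 : alpha ord0 = beta ord0.
  by have := congr1 (modn^~ N) E; rewrite !modnMDl !modn_small.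
have E1 : base_code N (alpha \o lift ord0) = base_code N (beta \o lift ord0).
  by move: E; rewrite E0 => /addIn/eqP; rewrite eqn_pmul2r// => /eqP.
move=> i; case: (unliftP ord0 i) => [j ->|-> //].
by apply: (IHn (alpha \o lift ord0) (beta \o lift ord0)) => //= k.
Qed.

(** The numbers 1, ..., [size p] would be more roots than a non-zero [p] can have. *)
Lemma poly_pos_root0 (p : {poly R}) : (forall x, 0 < x -> p.[x] = 0) -> p = 0.
Proof.
move=> p0; apply: (@roots_geq_poly_eq0 _ p [seq k.+1%:R | k <- iota 0 (size p)]).
- by apply/allP => _ /mapP[k _ ->]; apply/rootP; rewrite p0// ltr0n.
- by rewrite map_inj_uniq ?iota_uniq// => i j /eqP; rewrite eqr_nat => /eqP[].
- by rewrite size_map size_iota.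
Qed.

(** The monomial has degree [r.-1] and the Whitney factor adds one; written this way the exponent is
    also right for [r = 0]. *)
Lemma wpolyZ (nu : Bminus D r) k t s :
  wpoly nu (fun i => k * t i) s = k ^+ r.-1.+1 * wpoly nu t s :> R.
Proof.
rewrite /wpoly; under eq_bigr do rewrite exprMn.
rewrite big_split /= prodrXr (Bminus_sum nu) exprSr.
by ring.
Qed.

(** The Whitney factor is bilinear and alternating in [t] and [s]. *)
Lemma wpoly_shift (mu : triplet D) k (t s : 'I_D.+1 -> R) :
  wpoly mu t (fun i => s i + k * t i) = wpoly mu t s.
Proof. by rewrite /wpoly; ring. Qed.

(* A relation on the simplex extends to all positive [t] by homogeneity, and to
   all [s] because the Whitney factor only sees [s] modulo [t]. *)
Lemma wpoly_relation_cone (c : Bminus D r -> R) :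
  (forall t s, (forall i, 0 <= t i) -> \sum_i t i = 1 -> \sum_i s i = 0 ->
    \sum_nu c nu * wpoly nu t s = 0) ->
  forall t s, (forall i, 0 < t i) -> \sum_nu c nu * wpoly nu t s = 0.
Proof.
move=> rel t s t0; set T := \sum_i t i; set S := \sum_i s i.
have T0 : 0 < T.
  by rewrite /T big_ord_recl ltr_pwDl// sumr_ge0// => i _; rewrite ltW.
have TN0 : T != 0 by rewrite gt_eqF.
(* The scaling gives [t] sum 1, and the multiple of [t] is chosen to give the corrected [s] sum
   0. *)
have : \sum_nu c nu *
    wpoly nu (fun i => T^-1 * t i) (fun i => s i + - (S / T) * t i) = 0.
  apply: rel => [i||]; first by rewrite mulr_ge0 ?invr_ge0 ?ltW.
    by rewrite -mulr_sumr mulVf.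
  by rewrite big_split /= -mulr_sumr -/S -/T mulNr divfK ?subrr.
under eq_bigr do rewrite wpolyZ wpoly_shift mulrCA.
rewrite -mulr_sumr => /eqP; rewrite mulf_eq0 expf_eq0 /= invr_eq0 (negPf TN0).
by move=> /eqP.
Qed.

(* Substituting [t_i = x^(N^i)] with [N] larger than all exponents maps distinct
   monomials to distinct powers of [x]; the coefficient of the term [key nu0] is
   then [c nu0], since keys are distinct from each other and from cokeys. *)
Lemma wpoly_free (c : Bminus D r -> R) :
  (forall t s, (forall i, 0 <= t i) -> \sum_i t i = 1 -> \sum_i s i = 0 ->
    \sum_nu c nu * wpoly nu t s = 0) ->
  forall nu, c nu = 0.
Proof.
(* Raised exponents are at most [r.-1 + 1], which is below [r.+2] even for [r = 0]. *)
move=> /wpoly_relation_cone rel nu0; pose N := r.+2.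
pose j0 := (key nu0).2.
(* The image of [term k] when [s] is the indicator of [j0], which keeps only the terms with label
   [j0]. *)
pose monom (k : {ffun 'I_D.+1 -> nat} * 'I_D.+1) : {poly R} :=
  (k.2 == j0)%:R *: 'X^(base_code N k.1).
pose p := \sum_nu c nu *: (monom (key nu) - monom (cokey nu)).
have p0 : p = 0.
  apply: poly_pos_root0 => x x0.
  rewrite -(rel (fun i => x ^+ (N ^ i)) (fun i => (i == j0)%:R)); last first.
    by move=> i; rewrite exprn_gt0.
  rewrite horner_sum; apply: eq_bigr => nu _; rewrite hornerZ wpolyE.
  have mE k : (monom k).[x] =
      term k (fun i => x ^+ (N ^ i)) (fun i => (i == j0)%:R).
    rewrite /monom hornerZ hornerXn /term mulrC; congr (_ * _).
    rewrite /base_code -prodrXr; apply: eq_bigr => i _.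
    by rewrite -exprM mulnC.
  by rewrite hornerD hornerN !mE.
have raise_lt (nu : Bminus D r) i j : (raise (expo nu) i j < N)%N.
  have : (expo nu j <= r.-1)%N.
    by rewrite -(Bminus_sum nu) [X in (_ <= X)%N](bigD1 j)//= leq_addr.
  by rewrite ffunE /N; case: (j == i) => /=; lia.
have coefE (k : {ffun 'I_D.+1 -> nat} * 'I_D.+1) : (forall i, k.1 i < N)%N ->
    (monom k)`_(base_code N (key nu0).1) = (k == key nu0)%:R.
  move=> ltk; rewrite /monom coefZ coefXn -natrM mulnb; congr (nat_of_bool _)%:R.
  apply/andP/eqP => [[/eqP k2 /eqP/esym k1]|->]; last by rewrite !eqxx.
  rewrite [k]surjective_pairing [RHS]surjective_pairing.
  congr pair; last exact: k2.
  by apply/ffunP; apply: base_code_inj k1 => // i; exact: raise_lt.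
have := congr1 (fun q : {poly R} => q`_(base_code N (key nu0).1)) p0.
rewrite coef0 /p coef_sum (bigD1 nu0)//= big1 ?addr0.
  rewrite coefZ coefB !coefE; try by move=> i; exact: raise_lt.
  by rewrite eqxx eq_sym (negPf (key_neq_cokey _ _)) subr0 mulr1.
move=> nu nuE; rewrite coefZ coefB !coefE; try by move=> i; exact: raise_lt.
rewrite [cokey _ == _]eq_sym (negPf (key_neq_cokey _ _)) subr0.
by case: eqP => [/key_inj E|_]; [rewrite E eqxx in nuE|rewrite mulr0].
Qed.

End Independence.

(** * Transition matrices: existence, uniqueness, inverses and rows *)

Section Transition.
Variables (R : realType) (D : nat) (v : 'I_D.+1 -> 'rV[R]_D).
Hypothesis hv : nondegenerate_simplex v.
Variables xi lam : 'I_D.+1 -> 'rV[R]_D -> R.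
Hypotheses (hxi : barycentric v xi) (hlam : barycentric v lam).
Variable A : 'S_D.+1 -> 'rV[R]_D -> 'rV[R]_D.
Hypothesis hA : forall pi : 'S_D.+1,
  affine_map (A pi) /\ forall i, A pi (v i) = v (pi i).
Variable r : nat.

(** Points of the simplex are combinations with non-negative weights of sum 1, and tangent vectors
    are combinations with weights of sum 0. *)
Lemma is_transitionP (pi : 'S_D.+1) (M : 'M[R]_#|{: Bminus D r}|) :
  is_transition v xi lam A pi M <->
  (forall (mu : Bminus D r) t s,
     (forall i, 0 <= t i) -> \sum_i t i = 1 -> \sum_i s i = 0 ->
     wpoly mu (t \o pi) (s \o pi) = \sum_nu entry M mu nu * wpoly nu t s).
Proof.
have [aA Av] := hA (pi^-1)%g; split=> MP mu.
  move=> t s t0 t1 s0.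
  rewrite -(pullback_wform_comb mu hxi aA Av t1 s0) MP; last by exists t.
  by apply: eq_bigr => nu _; rewrite (wform_comb _ hlam t1 s0).
move=> _ [t [t0 t1 ->]] h.
have [s s0 ->] := direction_comb hv h; rewrite -/(comb v t).
rewrite (pullback_wform_comb mu hxi aA Av t1 s0) MP//.
by apply: eq_bigr => nu _; rewrite (wform_comb _ hlam t1 s0).
Qed.

Lemma entry_inj (M N : 'M[R]_#|{: Bminus D r}|) :
  (forall mu nu, entry M mu nu = entry N mu nu) -> M = N.
Proof.
move=> MN; apply/matrixP => i j.
by have := MN (enum_val i) (enum_val j); rewrite /entry !enum_valK.
Qed.

Lemma entry_mul (M N : 'M[R]_#|{: Bminus D r}|) mu rho :
  entry (M *m N) mu rho = \sum_nu entry M mu nu * entry N nu rho.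
Proof.
rewrite /entry mxE (reindex (@enum_rank (Bminus D r))) //.
exact: onW_bij (@enum_rank_bij _).
Qed.

Lemma wpoly_coef_uniq (a b : Bminus D r -> R) :
  (forall t s, (forall i, 0 <= t i) -> \sum_i t i = 1 -> \sum_i s i = 0 ->
    \sum_nu a nu * wpoly nu t s = \sum_nu b nu * wpoly nu t s) ->
  a =1 b.
Proof.
move=> E nu; apply/eqP; rewrite -subr_eq0.
apply/eqP/(@wpoly_free R D r (fun nu => a nu - b nu)) => t s t0 t1 s0.
by under eq_bigr do rewrite mulrBl; rewrite sumrB (E t s)// subrr.
Qed.

Lemma is_transition_uniq pi (M N : 'M[R]_#|{: Bminus D r}|) :
  is_transition v xi lam A pi M -> is_transition v xi lam A pi N -> M = N.
Proof.
move=> /is_transitionP MP /is_transitionP NP; apply: entry_inj => mu.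
by apply: wpoly_coef_uniq => t s t0 t1 s0; rewrite -MP// NP.
Qed.

Definition rule_mx (pi : 'S_D.+1) : 'M[R]_#|{: Bminus D r}| :=
  \matrix_(i, j) rule R pi (enum_val i : Bminus D r) (enum_val j : Bminus D r).

Lemma entry_rule_mx pi mu nu : entry (rule_mx pi) mu nu = rule R pi mu nu.
Proof. by rewrite /entry mxE !enum_rankK. Qed.

Lemma sum_delta (nu1 : Bminus D r) (c : R) (F : Bminus D r -> R) :
  \sum_nu c * (nu == nu1)%:R * F nu = c * F nu1.
Proof.
rewrite (bigD1 nu1)//= eqxx mulr1 big1 ?addr0// => nu /negPf->.
by rewrite mulr0 mul0r.
Qed.

Lemma is_transition_rule_mx pi : (1 <= r)%N ->
  is_transition v xi lam A pi (rule_mx pi).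
Proof.
move=> r1; apply/is_transitionP => mu t s _ _ _.
under eq_bigr do rewrite entry_rule_mx.
have [[nu1 [ruleE wE]]|[nu1 [nu2 [_ ruleE wE]]]] := @rule_row R D r pi mu r1.
  by rewrite wE; under eq_bigr do rewrite ruleE; rewrite sum_delta.
rewrite wE; under eq_bigr do rewrite ruleE mulrBl.
by rewrite sumrB; congr (_ - _); rewrite sum_delta.
Qed.

(** Row [mu] of the product expands [wpoly mu] at coordinates composed with [pi^-1] and then [pi],
    that is, unchanged; uniqueness of coefficients gives the identity. *)
Lemma is_transition_mulV pi (M N : 'M[R]_#|{: Bminus D r}|) :
  is_transition v xi lam A pi M -> is_transition v xi lam A (pi^-1)%g N ->
  M *m N = 1%:M.
Proof.
move=> /is_transitionP MP /is_transitionP NP; apply: entry_inj => mu.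
apply: wpoly_coef_uniq => t s t0 t1 s0.
have sumV (u : 'I_D.+1 -> R) : \sum_i (u \o (pi^-1)%g) i = \sum_i u i.
  by rewrite [RHS](reindex_inj (@perm_inj _ (pi^-1)%g)).
have compV (u : 'I_D.+1 -> R) : (u \o (pi^-1)%g) \o pi = u.
  by apply/funext => i /=; rewrite permK.
under eq_bigr do rewrite entry_mul big_distrl /=.
rewrite exchange_big /=.
under eq_bigr => nu _.
  under eq_bigr do rewrite -mulrA.
  rewrite -big_distrr /= -NP//; over.
rewrite /= -MP ?sumV//; last by move=> i /=.
rewrite !compV (bigD1 mu)//= /entry mxE eqxx mul1r big1 ?addr0// => nu numu.
by rewrite mxE (inj_eq enum_rank_inj) eq_sym (negPf numu) mul0r.
Qed.

Lemma rule_mx_row pi (mu : Bminus D r) : (1 <= r)%N ->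
  let c := edge_sign R (perm_edge pi (edge mu)) in
  row_single (rule_mx pi) mu c \/ row_double (rule_mx pi) mu c.
Proof.
move=> r1 c.
have [[nu1 [ruleE _]]|[nu1 [nu2 [nu12 ruleE _]]]] := @rule_row R D r pi mu r1.
  left; exists nu1; split=> [|nu /negPf nu1E]; rewrite entry_rule_mx ruleE.
    by rewrite eqxx mulr1.
  by rewrite nu1E mulr0.
right; exists nu1, nu2; split=> // [||nu /negPf nu1E /negPf nu2E];
  rewrite entry_rule_mx ruleE.
- by rewrite eqxx (negPf nu12) mulr1 mulr0 subr0.
- by rewrite eqxx eq_sym (negPf nu12) mulr1 mulr0 sub0r.
- by rewrite nu1E nu2E mulr0 subrr.
Qed.

End Transition.

Theorem corollary7 (R : realType) (D : nat) (hD : (1 <= D)%N)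
  (v : 'I_D.+1 -> 'rV[R]_D) (hv : nondegenerate_simplex v)
  (xi lam : 'I_D.+1 -> 'rV[R]_D -> R)
  (hxi : barycentric v xi) (hlam : barycentric v lam)
  (A : 'S_D.+1 -> 'rV[R]_D -> 'rV[R]_D)
  (hA : forall pi : 'S_D.+1,
      affine_map (A pi) /\ forall i, A pi (v i) = v (pi i)) :
  (forall (r : nat) (pi : 'S_D.+1), (1 <= r)%N ->
     exists! M : 'M[R]_#|{: Bminus D r}|, is_transition v xi lam A pi M) /\
  (forall T : forall r : nat, 'S_D.+1 -> 'M[R]_#|{: Bminus D r}|,
     (forall (r : nat) (pi : 'S_D.+1), (1 <= r)%N ->
        is_transition v xi lam A pi (T r pi)) ->
     [/\ forall (r : nat) (pi : 'S_D.+1), (1 <= r)%N ->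
           forall mu : Bminus D r,
             row_single (T r pi) mu (edge_sign R (perm_edge pi (edge mu))) \/
             row_double (T r pi) mu (edge_sign R (perm_edge pi (edge mu)))
       , forall (r : nat) (pi : 'S_D.+1), (1 <= r)%N ->
           T r pi \in unitmx /\ invmx (T r pi) = T r (pi^-1)%g
       & exists rule : 'S_D.+1 -> triplet D -> triplet D -> R,
           degree_independent rule /\
           forall (r : nat) (pi : 'S_D.+1), (1 <= r)%N ->
             forall mu nu : Bminus D r,
               entry (T r pi) mu nu = rule pi mu nu]).
Proof.
(* By uniqueness every transition matrix is [rule_mx], so rows and entries can be read off there. *)
have ruleT r pi M : (1 <= r)%N -> is_transition v xi lam A pi M ->
    M = rule_mx R r pi.
  move=> r1 MP; apply: (is_transition_uniq hv hxi hlam hA MP).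
  exact: is_transition_rule_mx.
split=> [r pi r1|T TP].
  exists (rule_mx R r pi); split; first exact: is_transition_rule_mx.
  by move=> M /(ruleT _ _ _ r1).
split=> [r pi r1 mu|r pi r1|].
- by rewrite (ruleT _ _ _ r1 (TP r pi r1)); exact: rule_mx_row.
(* For square matrices a right inverse is the inverse. *)
- have TT := is_transition_mulV hv hxi hlam hA (TP r pi r1) (TP r _ r1).
  have [Tu _] := mulmx1_unit TT; split=> //.
  by rewrite -[LHS]mulmx1 -TT mulKmx.
exists (rule R (D := D)); split; first exact: rule_degree_independent.
by move=> r pi r1 mu nu; rewrite (ruleT _ _ _ r1 (TP r pi r1)) entry_rule_mx.
Qed.
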